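(* There exist a finite vertex set $V$, a partition $\Pi^2=(U,W)$ of $V$ into two classes, $k\in\mathbb{N}$, a degree sequence $\mathbf{d}$ on $V$, and two graphs $G,G'$ on $V$, both with degree sequence $\mathbf{d}$ and both consistent with the skeleton graph $\mathcal{S}(k)$ (on the partition $\Pi^2$), such that there exists no sequence of $\mathcal{S}$-preserving swaps that turns $G$ into $G'$, where $\mathcal{S}=\mathcal{S}(k)$.
   Context: Graphs are finite and simple. Given a degree sequence $\mathbf{d}$ on $V$, a partition $(U,W)$ of $V$ and $k\in\mathbb{N}$, the skeleton graph $\mathcal{S}(k)$ has the classes $U,W$ as vertices, a bone $UW$ of weight $k$, and a loop at each class with weight forced by $\mathbf{d}$ and $k$. A graph $G$ on $V$ with degree sequence $\mathbf{d}$ is consistent with $\mathcal{S}(k)$ if $G$ has exactly $k$ edges between $U$ and $W$ (the numbers of edges inside $U$ and inside $W$ are then determined and equal the loop weights). Swap: if $a,b,c,d$ are (distinct) vertices of $G=(V,E)$ with $ab,cd\in E$ and $bc,ad\notin E$, the swap $ab,cd\Rightarrow bc,ad$ replaces $G$ by $G_1=(V,(E\cup\{bc,ad\})\setminus\{ab,cd\})$. The swap is $\mathcal{S}$-preserving if both $G$ and $G_1$ are consistent with $\mathcal{S}$. *)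

(* Defs.v *)
From mathcomp Require Import all_boot.

Set Implicit Arguments.
Unset Strict Implicit.
Unset Printing Implicit Defensive.

Section Graphs.
Variable V : finType.
Implicit Types (E : {set {set V}}) (U W : {set V}) (d : V -> nat).

(* A graph on V is given by its edge set; an edge is a 2-element set. *)
Definition simple_graph E : bool := [forall e in E, #|e| == 2].

Definition degree E (v : V) : nat := #|[set e in E | v \in e]|.

Definition has_degree_sequence E d : Prop := forall v, degree E v = d v.

(* [partition] rules out empty classes; U != W is needed because
   [set U; U] = [set U]. *)
Definition partition2 U W : bool :=
  (U != W) && partition [set U; W] [set: V].

Definition edges_inside E U : {set {set V}} := [set e in E | e \subset U].

Definition edges_between E U W : {set {set V}} :=
  [set e in E | (e :&: U != set0) && (e :&: W != set0)].

Record skeleton := Skeleton {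
  classU : {set V};
  classW : {set V};
  bone : nat;
  loopU : nat;
  loopW : nat
}.

(* The degrees in a class count each edge inside it twice and each of the
   k crossing edges once. *)
Definition loop_weight d (k : nat) U : nat := (\sum_(v in U) d v - k)./2.

Definition skeleton_graph d U W (k : nat) : skeleton :=
  Skeleton U W k (loop_weight d k U) (loop_weight d k W).

(* The loop weights are matched automatically: see consistent_loops. *)
Definition consistent (S : skeleton) E : bool :=
  #|edges_between E (classU S) (classW S)| == bone S.

(* The pairwise distinctness of a, b, c, d must be required: for b = c,
   [set b; c] is a singleton, hence never an edge. *)
Definition swappable E (a b c d : V) : bool :=
  [&& uniq [:: a; b; c; d],
      [set a; b] \in E, [set c; d] \in E,
      [set b; c] \notin E & [set a; d] \notin E].

Definition swap E (a b c d : V) : {set {set V}} :=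
  (E :|: [set [set b; c]; [set a; d]]) :\: [set [set a; b]; [set c; d]].

Definition preserving_swap (S : skeleton) : rel {set {set V}} :=
  fun E E1 =>
    [&& consistent S E, consistent S E1 &
        [exists a, exists b, exists c, exists d,
          swappable E a b c d && (E1 == swap E a b c d)]].

Lemma partition2C U W : partition2 U W = partition2 W U.
Proof. by rewrite /partition2 eq_sym setUC. Qed.

Lemma edges_betweenC E U W : edges_between E U W = edges_between E W U.
Proof. by apply/setP=> e; rewrite !inE [X in _ && X]andbC. Qed.

Lemma partition2_compl U W : partition2 U W -> W = ~: U.
Proof.
case/andP=> nUW /and3P[/eqP cov /trivIsetP tI _].
have dUW : [disjoint U & W] by apply: tI => //; rewrite !inE eqxx ?orbT.
apply/setP=> x; rewrite inE.
have := in_setT x; rewrite -cov => /bigcupP[B].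
rewrite !inE => /orP[] /eqP-> xB; first by rewrite xB (disjointFr dUW xB).
by rewrite xB (disjointFl dUW xB).
Qed.

Lemma sum_degrees_class E U W d :
  simple_graph E -> has_degree_sequence E d -> partition2 U W ->
  \sum_(v in U) d v = (#|edges_inside E U|).*2 + #|edges_between E U W|.
Proof.
move=> /forall_inP sE degE /partition2_compl->.
under eq_bigr do rewrite -degE /degree -sum1dep_card.
rewrite (exchange_big_dep (mem E)) /=; last by move=> ? ? _ /andP[].
rewrite -muln2 -!sum1dep_card big_distrl /= !big_mkcondr -big_split /=.
apply: eq_bigr => e eE; rewrite sum1dep_card eE.
have -> : #|[set v in U | true && (v \in e)]| = #|e :&: U|.
  by apply: eq_card => v; rewrite !inE andbC.
have := cardsID U e; rewrite (eqP (sE e eE)) setDE.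
rewrite -!card_gt0 -setD_eq0 -cards_eq0 setDE.
by move: #|e :&: U| #|_ :&: ~: U| => [|[|[|x]]] [|[|[|y]]].
Qed.

Lemma consistent_loops E U W d k :
  simple_graph E -> has_degree_sequence E d -> partition2 U W ->
  consistent (skeleton_graph d U W k) E ->
  #|edges_inside E U| = loopU (skeleton_graph d U W k) /\
  #|edges_inside E W| = loopW (skeleton_graph d U W k).
Proof.
move=> sE degE pUW /eqP /= bEk; rewrite /loop_weight.
rewrite (sum_degrees_class sE degE pUW) bEk addnK doubleK; split=> //.
rewrite (sum_degrees_class sE degE (W := U)) 1?partition2C //.
by rewrite edges_betweenC bEk addnK doubleK.
Qed.

End Graphs.

(* Main.v *)
Require Import Defs.
From mathcomp Require Import all_boot.

(** The example has eight vertices, four in each class: a hub, a leaf and two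
    middle vertices.  In every graph considered, the two hubs are adjacent to
    each other and to all four middle vertices, each leaf hangs from one hub,
    and the middle vertices induce a perfect matching; hence all degrees agree
    (6 for hubs, 3 for middle vertices, 1 for leaves).  In G each leaf hangs
    from the hub of its own class and the matching crosses between the
    classes; in G' each leaf hangs from the hub of the other class and the
    matching stays inside the classes.  Both graphs have 7 crossing edges: the
    four between hubs and middle vertices, the one between the hubs, and either
    the two matching edges or the two leaf edges.

    Preserving swaps never exchange the leaves of G.  Each vertex of a swap
    loses one neighbour in the swap and gains another.  A leaf can only lose its
    hub, and a hub can only gain the one leaf that it is not adjacent to; hence
    a swap with a leaf or a hub takes both leaves and both hubs and exchanges
    the leaves.  This replaces two inner edges by two crossing ones.  The other
    swaps change the matching on the middle vertices, and only the one leading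
    to the second crossing matching preserves the number of crossing edges.  So
    preserving swaps only alternate between the two graphs [crossing_graph true]
    and [crossing_graph false] that differ by this matching
    ([preserving_swap_crossing_graph]), and G' is neither of them.

    That case analysis is finite and is left to evaluation.  Since finite sets
    do not evaluate, graphs are described by boolean relations, through which
    degrees, crossing edges and swaps are expressed by computable formulas. *)

Set Implicit Arguments.
Unset Strict Implicit.
Unset Printing Implicit Defensive.

(** * Graphs given by a relation *)

Section RelationGraphs.
Variable V : finType.
Implicit Types (r : rel V) (E F U : {set {set V}}) (a b c d p q v : V).

Definition graph_of r : {set {set V}} :=
  [set e | [exists p, exists q, r p q && (e == [set p; q])]].

Definition same_pair p q b c : bool :=
  (p == b) && (q == c) || (p == c) && (q == b).

Lemma eq_set2 p q b c : ([set p; q] == [set b; c]) = same_pair p q b c.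
Proof.
apply/eqP/orP => [eqs | [] /andP[/eqP-> /eqP->] //]; last exact: setUC.
have: (p \in [set b; c]) && (q \in [set b; c]) by rewrite -eqs set21 set22.
have: (b \in [set p; q]) && (c \in [set p; q]) by rewrite eqs set21 set22.
case/andP=> /set2P[->|->] /set2P[->|->]; rewrite !inE !eqxx ?orbT /=.
- by rewrite orbb => ->; left.
- by left.
- by right.
- by rewrite orbb andbT => ->; left.
Qed.

Lemma mem_graph_of r p q : symmetric r ->
  ([set p; q] \in graph_of r) = r p q.
Proof.
move=> symr; rewrite inE; apply/existsP/idP => [[b /existsP[c]] | rpq].
  by rewrite eq_set2 => /andP[rbc /orP[] /andP[/eqP-> /eqP->] //]; rewrite symr.
by exists p; apply/existsP; exists q; rewrite rpq eqxx.
Qed.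

Lemma simple_graph_of r : irreflexive r -> simple_graph (graph_of r).
Proof.
move=> irr; apply/forall_inP => e; rewrite inE => /existsP[p /existsP[q]].
case/andP=> rpq /eqP->; rewrite cards2.
by rewrite (_ : p != q) //; apply: contraTneq rpq => ->; rewrite irr.
Qed.

Lemma simple_graph_edge E e : simple_graph E -> e \in E ->
  exists p q, p != q /\ e = [set p; q].
Proof.
by move=> /forall_inP sE /sE /cards2P.
Qed.

Lemma simple_graph_eq E F : simple_graph E -> simple_graph F ->
  (forall p q, ([set p; q] \in E) = ([set p; q] \in F)) -> E = F.
Proof.
move=> sE sF eqEF; apply/setP => e; apply/idP/idP => eE.
  by have [p [q [_ def_e]]] := simple_graph_edge sE eE; rewrite def_e -eqEF -def_e.
by have [p [q [_ def_e]]] := simple_graph_edge sF eE; rewrite def_e eqEF -def_e.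
Qed.

Lemma degree_simple E v : simple_graph E ->
  degree E v = #|[pred w | [set v; w] \in E]|.
Proof.
move=> sE; rewrite /degree -(card_in_imset (f := fun w => [set v; w])).
  apply: eq_card => e; rewrite inE; apply/andP/imsetP => [[eE]|[w Ew ->]].
    have [p [q [_ def_e]]] := simple_graph_edge sE eE; move: eE; rewrite def_e.
    rewrite !inE => pqE /orP[] /eqP->; first by exists q; rewrite // inE.
    by exists p; rewrite ?inE setUC.
  by rewrite !inE eqxx.
move=> w w' Ew _ /eqP; rewrite eq_set2 => /orP[/andP[_ /eqP //]|].
by case/andP=> /eqP <- /eqP->.
Qed.

(** A crossing edge has exactly one orientation from the first class to the
    second, so crossing edges are counted by ordered pairs. *)
Lemma card_edges_between E (U : {set V}) : simple_graph E ->
  #|edges_between E U (~: U)| =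
  #|[pred x : V * V | [&& x.1 \in U, x.2 \notin U & [set x.1; x.2] \in E]]|.
Proof.
move=> sE; rewrite -(card_in_imset (f := fun x : V * V => [set x.1; x.2])).
  apply: eq_card => e; rewrite inE; apply/andP/imsetP => [[eE]|[[p q]]].
    have [p [q [_ def_e]]] := simple_graph_edge sE eE; rewrite def_e in eE *.
    case/andP=> /set0Pn[y +] /set0Pn[z +]; rewrite !inE.
    case/andP=> /orP[] /eqP-> yU /andP[/orP[] /eqP-> zU].
    - by rewrite yU in zU.
    - by exists (p, q); rewrite // inE /= yU zU.
    - by exists (q, p); rewrite ?inE /= ?yU ?zU setUC.
    - by rewrite yU in zU.
  rewrite inE /= => /and3P[pU qU pqE] ->; split=> //.
  apply/andP; split; apply/set0Pn; [exists p | exists q].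
    by rewrite !inE eqxx pU.
  by rewrite !inE eqxx qU orbT.
move=> [p q] [p' q'] /and3P[/= pU qU _] /and3P[/= p'U q'U _] /eqP.
rewrite eq_set2 => /orP[] /andP[/eqP eqp /eqP eqq]; first by rewrite eqp eqq.
by rewrite eqp (negbTE q'U) in pU.
Qed.

Definition swap_rel r a b c d : rel V := fun p q =>
  [&& ~~ same_pair p q a b, ~~ same_pair p q c d &
      [|| r p q, same_pair p q b c | same_pair p q a d]].

Lemma simple_swap E a b c d : simple_graph E -> swappable E a b c d ->
  simple_graph (swap E a b c d).
Proof.
move=> /forall_inP sE /and5P[/= + _ _ _ _].
rewrite !inE !negb_or -!andbA => /and4P[_ _ nad] /and3P[nbc _ _].
apply/forall_inP => e; rewrite !inE => /andP[_ /orP[/sE // | /orP[] /eqP->]].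
  by rewrite cards2 nbc.
by rewrite cards2 nad.
Qed.

Lemma mem_swap r a b c d p q : symmetric r ->
  ([set p; q] \in swap (graph_of r) a b c d) = swap_rel r a b c d p q.
Proof.
move=> symr; rewrite in_setD in_set2 in_setU mem_graph_of // in_set2.
by rewrite !eq_set2 negb_or -andbA.
Qed.

Lemma partition2_setC (U : {set V}) : U != set0 -> ~: U != set0 ->
  partition2 U (~: U).
Proof.
move=> U0 UC0; have nUC : U != ~: U.
  apply: contraNneq U0 => eqU; rewrite -(setIid U) {2}eqU setICr //.
rewrite /partition2 nUC /=; apply/and3P; split.
- by rewrite /cover big_setU1 ?inE //= big_set1 setUCr.
- apply/trivIsetP => A B; rewrite !inE => /orP[] /eqP-> /orP[] /eqP->;
    by rewrite ?eqxx // -setI_eq0 ?setICr // setIC setICr.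
- by rewrite in_set2 ![set0 == _]eq_sym negb_or U0.
Qed.

End RelationGraphs.

(** * The eight-vertex example *)

(** The first component is the class of a vertex.  The other two are
    [(true, i)] for the middle vertex number [i], [(false, true)] for the hub
    and [(false, false)] for the leaf. *)
Definition vertex : finType := (bool * (bool * bool))%type.

Definition vertices : seq vertex :=
  let bs := [:: true; false] in
  [seq (s, x) | s <- bs, x <- [seq (m, i) | m <- bs, i <- bs]].

Lemma mem_vertices p : p \in vertices.
Proof. by case: p => [[] [[] []]]. Qed.

Lemma card_vertices (P : pred vertex) : #|P| = count P vertices.
Proof.
rewrite -size_filter -(card_uniqP (filter_uniq P (isT : uniq vertices))).
by apply: eq_card => p; rewrite mem_filter mem_vertices andbT.
Qed.

Definition vertex_pairs : seq (vertex * vertex) :=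
  [seq (p, q) | p <- vertices, q <- vertices].

Lemma card_vertex_pairs (P : pred (vertex * vertex)) :
  #|P| = count P vertex_pairs.
Proof.
have uniq_pairs : uniq vertex_pairs by vm_compute.
rewrite -size_filter -(card_uniqP (filter_uniq P uniq_pairs)).
by apply: eq_card => -[p q]; rewrite mem_filter allpairs_f ?andbT // mem_vertices.
Qed.

Lemma all_vertices (P : pred vertex) : all P vertices -> forall p, P p.
Proof. by move=> /allP allP p; apply: allP; apply: mem_vertices. Qed.

Definition first_class : {set vertex} := [set p | p.1].

Lemma card_crossing (E : {set {set vertex}}) (r : rel vertex) :
  simple_graph E -> (forall p q, ([set p; q] \in E) = r p q) ->
  #|edges_between E first_class (~: first_class)| =
  count (fun x => [&& x.1.1, ~~ x.2.1 & r x.1 x.2]) vertex_pairs.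
Proof.
move=> sE rE; rewrite card_edges_between // card_vertex_pairs.
by apply: eq_count => -[p q] /=; rewrite !inE rE.
Qed.

(** With [home] each leaf hangs from the hub of its own class, otherwise from
    the hub of the other class; [M] is the matching on the middle vertices. *)
Definition hub_rel (home : bool) (M : rel (bool * bool)) : rel vertex :=
  fun p q => match p, q with
  | (s, (true, i)), (s', (true, j)) => M (s, i) (s', j)
  | (_, (true, _)), (_, (false, hub)) => hub
  | (_, (false, hub)), (_, (true, _)) => hub
  | (s, (false, true)), (s', (false, true)) => s != s'
  | (_, (false, false)), (_, (false, false)) => false
  | (s, (false, _)), (s', (false, _)) => (s == s') == home
  end.

Definition crossing_matching (t : bool) : rel (bool * bool) :=
  fun x y => (x.1 != y.1) && ((x.2 == y.2) == t).

Definition inner_matching : rel (bool * bool) :=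
  fun x y => (x.1 == y.1) && (x.2 != y.2).

Definition crossing_graph_rel t := hub_rel true (crossing_matching t).
Definition inner_graph_rel := hub_rel false inner_matching.

Definition crossing_graph t := graph_of (crossing_graph_rel t).
Definition inner_graph := graph_of inner_graph_rel.

Definition vertex_degree (p : vertex) : nat :=
  match p.2 with (true, _) => 3 | (false, true) => 6 | (false, false) => 1 end.

Definition example_skeleton : skeleton vertex :=
  skeleton_graph vertex_degree first_class (~: first_class) 7.

Lemma hub_rel_sym home M : symmetric M -> symmetric (hub_rel home M).
Proof.
move=> symM [s [[] []]] [s' [[] []]] //=; by [apply: symM | rewrite [s == _]eq_sym].
Qed.

Lemma hub_rel_irr home M : irreflexive M -> irreflexive (hub_rel home M).
Proof. by move=> irrM [s [[] i]] /=; [apply: irrM | case: i; rewrite ?eqxx]. Qed.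

Lemma crossing_graph_rel_sym t : symmetric (crossing_graph_rel t).
Proof.
by apply: hub_rel_sym => x y; rewrite /crossing_matching eq_sym [_.2 == _]eq_sym.
Qed.

Lemma inner_graph_rel_sym : symmetric inner_graph_rel.
Proof.
by apply: hub_rel_sym => x y; rewrite /inner_matching eq_sym [_.2 == _]eq_sym.
Qed.

Lemma crossing_graph_simple t : simple_graph (crossing_graph t).
Proof.
by apply/simple_graph_of/hub_rel_irr => x; rewrite /crossing_matching eqxx.
Qed.

Lemma inner_graph_simple : simple_graph inner_graph.
Proof.
by apply/simple_graph_of/hub_rel_irr => x; rewrite /inner_matching !eqxx.
Qed.

Lemma has_vertex_degree (r : rel vertex) : symmetric r ->
  simple_graph (graph_of r) ->
  all (fun p => count (r p) vertices == vertex_degree p) vertices ->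
  has_degree_sequence (graph_of r) vertex_degree.
Proof.
move=> symr sr /all_vertices degr p; rewrite degree_simple // card_vertices.
by rewrite -(eqP (degr p)); apply: eq_count => q; rewrite /= mem_graph_of.
Qed.

Lemma consistent_graph_of (r : rel vertex) : symmetric r ->
  simple_graph (graph_of r) ->
  count (fun x => [&& x.1.1, ~~ x.2.1 & r x.1 x.2]) vertex_pairs = 7 ->
  consistent example_skeleton (graph_of r).
Proof.
move=> symr sr nr; apply/eqP; rewrite -[RHS]nr; apply: card_crossing => // p q.
exact: mem_graph_of.
Qed.

(** The finite case analysis: the swaps of the graph that leave 7 crossing
    edges all yield the other crossing matching.  Conditionals replace
    implications because call-by-value evaluation would compute the conclusion
    of an implication for all 4096 quadruples, most of which are no swaps. *)
Lemma crossing_graph_swap_check t :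
  let r := crossing_graph_rel t in
  all (fun a => all (fun b => all (fun c => all (fun d =>
    if [&& uniq [:: a; b; c; d], r a b, r c d, ~~ r b c & ~~ r a d] then
      if count (fun x => [&& x.1.1, ~~ x.2.1 & swap_rel r a b c d x.1 x.2])
           vertex_pairs == 7
      then all (fun p => all (fun q =>
        swap_rel r a b c d p q == crossing_graph_rel (~~ t) p q)
        vertices) vertices
      else true
    else true)
  vertices) vertices) vertices) vertices.
Proof. by case: t; vm_compute. Qed.

Lemma preserving_swap_crossing_graph t E :
  preserving_swap example_skeleton (crossing_graph t) E ->
  E = crossing_graph (~~ t).
Proof.
case/and3P=> _ cE /existsP[a /existsP[b /existsP[c /existsP[d]]]].
case/andP=> abcd /eqP def_E; have symr := crossing_graph_rel_sym t.
have sE : simple_graph E.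
  by rewrite def_E; apply: simple_swap abcd; apply: crossing_graph_simple.
have memE p q :
    ([set p; q] \in E) = swap_rel (crossing_graph_rel t) a b c d p q.
  by rewrite def_E; apply: mem_swap.
move: cE; rewrite /consistent (card_crossing sE memE) => cE.
move: abcd; rewrite /swappable !mem_graph_of // => abcd.
have /all_vertices/(_ a)/all_vertices/(_ b) := crossing_graph_swap_check t.
move=> /all_vertices/(_ c)/all_vertices/(_ d); rewrite abcd cE => eqr.
apply: simple_graph_eq => // [|p q].
  exact: crossing_graph_simple.
rewrite memE mem_graph_of; last exact: crossing_graph_rel_sym.
by move: eqr => /all_vertices/(_ p)/all_vertices/(_ q)/eqP.
Qed.

Lemma path_crossing_graph t p :
  path (preserving_swap example_skeleton) (crossing_graph t) p ->
  exists t', last (crossing_graph t) p = crossing_graph t'.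
Proof.
elim: p t => [|E p IHp] t /=; first by exists t.
by case/andP=> /preserving_swap_crossing_graph-> /IHp.
Qed.

Lemma crossing_graph_neq_inner t : crossing_graph t <> inner_graph.
Proof.
(* The leaf and the hub of one class are adjacent in the first graph only. *)
move=> /setP/(_ [set (true, (false, true)); (true, (false, false))]).
rewrite !mem_graph_of //; [exact: inner_graph_rel_sym|].
exact: crossing_graph_rel_sym.
Qed.

Theorem theorem3p3 :
  exists (V : finType) (U W : {set V}) (k : nat) (d : V -> nat)
         (G G' : {set {set V}}),
    partition2 U W
    /\ (simple_graph G /\ has_degree_sequence G d
        /\ consistent (skeleton_graph d U W k) G)
    /\ (simple_graph G' /\ has_degree_sequence G' d
        /\ consistent (skeleton_graph d U W k) G')
    /\ ~ (exists p : seq {set {set V}},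
            path (preserving_swap (skeleton_graph d U W k)) G p
            /\ last G p = G').
Proof.
exists vertex, first_class, (~: first_class), 7, vertex_degree.
exists (crossing_graph true), inner_graph.
have sG := crossing_graph_simple true; have sG' := inner_graph_simple.
have symG := crossing_graph_rel_sym true; have symG' := inner_graph_rel_sym.
split; last split; last split.
- apply: partition2_setC; apply/set0Pn.
    by exists (true, (true, true)); rewrite inE.
  by exists (false, (true, true)); rewrite !inE.
- split=> //; split; first exact: has_vertex_degree.
  exact: consistent_graph_of.
- split=> //; split; first exact: has_vertex_degree.
  exact: consistent_graph_of.
case=> p [/path_crossing_graph[t ->]]; exact: crossing_graph_neq_inner.
Qed.
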